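(* Suppose demand is IID on $[0,\bar D]$, the holding and shortage coefficients $h,p>0$ are constant over time, and ordering has zero fixed and per-unit costs and zero lead time. Let $$g(y)=\mathbb E\left[h(y-D)^++p(D-y)^+\right],\qquad s^*:=\min\arg\min_{y\in[0,\bar D]}g(y),$$ where $D$ has the common demand law, and let $\pi_s$ be the stationary base-stock policy with level $s\in[0,\bar D]$. In either the backlog or lost-sales model with horizon $T$, $\pi_{s^*}$ is optimal and $$\sup_{x_1\in[0,\bar D]}\left[V_1^{\pi_s}(x_1)-V_1^*(x_1)\right]\le T\left[g(s)-g(s^* )\right].$$ If $x_1\le\min\{s,s^*\}$ (with $x_1\in[0,\bar D]$), equality holds: $$V_1^{\pi_s}(x_1)-V_1^*(x_1)=T\left[g(s)-g(s^* )\right].$$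
   Context: Inventory model. Horizon $T$; $u^+=\max\{u,0\}$. Demands $D_1,\ldots,D_T$ are IID with a common law on $[0,\bar D]$, $\bar D>0$. Starting period $t$ with inventory $x_t$, the retailer chooses a post-order level $y_t\ge\max\{x_t,0\}$ before observing demand and incurs $h(y_t-D_t)^++p(D_t-y_t)^+$. The next state is $y_t-D_t$ in the backlog model (demand observed) and $(y_t-D_t)^+$ in the lost-sales model (only sales $\min\{D_t,y_t\}$ observed). Terminal salvage value is zero. Feasible policies use the information then available and may randomize; $V_1^\pi(x)$ is the expected total cost over $T$ periods from initial inventory $x$, and $V_1^*(x)=\inf_\pi V_1^\pi(x)$. The policy $\pi_s$ chooses post-order level $\max\{x,s\}$ at state $x$ in every period. *)

(* Defs.v *)
From HB Require Import structures.
From mathcomp Require Import all_boot all_order all_algebra.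
From mathcomp Require Import all_classical all_reals all_analysis.

Set Implicit Arguments.
Unset Strict Implicit.
Unset Printing Implicit Defensive.

Import Order.TTheory GRing.Theory Num.Theory.
Import numFieldNormedType.Exports.

Local Open Scope classical_set_scope.
Local Open Scope ring_scope.

Variant inventory_model := backlog | lost_sales.

(* Periods 1, ..., T are numbered 0, ..., T - 1. *)

Section Demand.
Context (R : realType) (d : measure_display) (Omega : measurableType d).
Context (P : probability Omega R).

(* Only the first T members of the sequence D are constrained.  Taking some of
   the B t to be the whole line gives the product rule for every subfamily. *)
Definition independent_upto (T : nat) (D : nat -> {RV P >-> R}) : Prop :=
  forall B : nat -> set R, (forall t, measurable (B t)) ->
    P [set w | forall t, (t < T)%N -> B t (D t w)] =
    (\prod_(t < T) P (D t @^-1` B t))%E.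

Definition iid_upto (mu : probability R R) (T : nat)
    (D : nat -> {RV P >-> R}) : Prop :=
  independent_upto T D /\
  forall t, (t < T)%N ->
    forall A : set R, measurable A -> distribution P (D t) A = mu A.

End Demand.

Section Model.
Context (R : realType) (m : inventory_model).

Definition period_cost (h p y d : R) : R :=
  h * Num.max (y - d) 0 + p * Num.max (d - y) 0.

Definition next_state (y d : R) : R :=
  if m is backlog then y - d else Num.max (y - d) 0.

Definition observation (y d : R) : R :=
  if m is backlog then d else Num.min d y.

(* One past period: starting inventory, post-order level, observation. *)
Definition record_type : Type := (R * R * R)%type.

(* A possibly randomized policy: a private random seed, drawn independently of
   the demands from an arbitrary probability space, and for every period t a
   post-order level depending on the seed, the records of the t past periods
   (most recent first) and the current inventory. *)
Record policy := Policy {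
  seed_display : measure_display ;
  seed : measurableType seed_display ;
  seed_law : probability seed R ;
  level : forall t : nat, seed * t.-tuple record_type * R -> R }.

Definition feasible (pi : policy) : Prop :=
  (forall t, measurable_fun setT (@level pi t)) /\
  (forall t (i : seed pi * t.-tuple record_type * R),
     Num.max i.2 0 <= level i).

(* The seed is irrelevant: it ranges over a one-point space. *)
Definition base_stock (s : R) : policy :=
  @Policy _ unit \d_tt (fun t i => Num.max i.2 s).

(* Past records and current inventory at the start of period t, from initial
   inventory x, seed u and demand path dem. *)
Fixpoint information (pi : policy) (u : seed pi) (x : R) (dem : nat -> R)
    (t : nat) : t.-tuple record_type * R :=
  if t is t'.+1 then
    let i := information u x dem t' in
    let y := level (u, i.1, i.2) in
    ([tuple of (i.2, y, observation y (dem t')) :: i.1],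
     next_state y (dem t'))
  else ([tuple], x).

Definition order_level (pi : policy) (u : seed pi) (x : R) (dem : nat -> R)
    (t : nat) : R :=
  let i := information u x dem t in level (u, i.1, i.2).

Definition total_cost (h p : R) (T : nat) (pi : policy) (u : seed pi) (x : R)
    (dem : nat -> R) : R :=
  \sum_(t < T) period_cost h p (order_level u x dem t) (dem t).

Context (d : measure_display) (Omega : measurableType d).
Context (P : probability Omega R) (D : nat -> {RV P >-> R}).
Context (h p : R) (T : nat).

Definition expected_cost (pi : policy) (x : R) : \bar R :=
  (\int[P \x seed_law pi]_w
     (total_cost h p T w.2 x (fun t => D t w.1))%:E)%E.

Definition optimal_cost (x : R) : \bar R :=
  ereal_inf [set v | exists2 pi, feasible pi & v = expected_cost pi x].

Definition optimal (pi : policy) : Prop :=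
  feasible pi /\ forall x, expected_cost pi x = optimal_cost x.

End Model.

Section OnePeriod.
Context (R : realType) (mu : probability R R) (h p Dbar : R).

Definition mean_cost (y : R) : R := \int[mu]_d period_cost h p y d.

Definition minimizers : set R :=
  [set y | y \in `[0, Dbar] /\
     forall z, z \in `[0, Dbar] -> mean_cost y <= mean_cost z].

(* The infimum is only a total-function encoding of the minimum; that it is
   attained has to be stated separately. *)
Definition least_minimizer : R := inf minimizers.

End OnePeriod.

(* Main.v *)
(* Past demands and the seed determine the order level y_t, and D_t is
   independent of both, so every policy costs the sum over t of E[g(y_t)].
   Writing a_t = x - (D_0 + ... + D_{t-1}), a feasible policy always has
   y_t >= a_t, while the base-stock policy with level s >= 0 has
   y_t = max(s, a_t), in both models, as soon as the demands are nonnegative.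
   Let r be the least minimizer of g.  Since g is convex with global minimum at
   r, the level max(r, a) minimizes g on [a, +oo[, which gives optimality, and
   g(max(s, a)) - g(max(r, a)) <= g(s) - g(r) for every a, with equality when
   a <= min(s, r); summing over t gives the two regret statements. *)

Require Import Defs.
From HB Require Import structures.
From mathcomp Require Import all_boot all_order all_algebra.
From mathcomp Require Import all_classical all_reals all_analysis.
From mathcomp Require Import measurable_realfun ring lra.
Import Order.TTheory GRing.Theory Num.Theory.
Import numFieldNormedType.Exports.
Local Open Scope classical_set_scope.
Local Open Scope ring_scope.

(** * Independence and integration on product spaces *)

Section Independence.
Local Open Scope ereal_scope.

(** Dynkin's pi-lambda argument: the measurable [A] with [P (A]&[C) = P A * P C] form a Dynkin
    system, which contains the pi-system [G] and hence [<<s G>>]. *)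
Lemma g_sigma_algebra_indep {R : realType} {d} {X : measurableType d}
    (P : probability X R) (G : set (set X)) (C : set X) :
    G `<=` measurable -> setI_closed G -> measurable C ->
    (forall A, G A -> P (A `&` C) = P A * P C) ->
  forall A, <<s G >> A -> P (A `&` C) = P A * P C.
Proof.
move=> Gm GI mC GC.
pose H := [set A | measurable A /\ P (A `&` C) = P A * P C].
suff GH : <<s G >> `<=` H by move=> A /GH[].
rewrite -setI_closed_g_dynkin_g_sigma_algebra//.
apply: smallest_sub; last by move=> A GA; split; [exact: Gm|exact: GC].
split.
- by split => //; rewrite setTI probability_setT mul1e.
- move=> A [mA PA]; split; first exact: measurableC.
  have -> : P (~` A `&` C) = P C - P (A `&` C).
    rewrite setIC -setDE measureD//; last by rewrite ltey_eq fin_num_measure.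
    by rewrite setIC.
  rewrite PA probability_setC// muleBl ?fin_num_adde_defr ?fin_num_measure//.
  by rewrite mul1e.
- move=> F tF HF; have mF n : measurable (F n) by have [] := HF n.
  split; first exact: bigcupT_measurable.
  rewrite setI_bigcupl !measure_bigcup//; last 2 first.
  + by move=> n _; exact: measurableI.
  + by apply: trivIset_setIr.
  rewrite -[X in _ * X]fineK ?fin_num_measure// muleC -nneseriesZl//.
  apply: eq_eseriesr => n _; rewrite fineK ?fin_num_measure// muleC.
  by have [] := HF n.
Qed.

(** The joint law of [(Z, Y)] agrees on rectangles with the product of the law of [Z] and [mu], so
    the two measures are equal and Tonelli applies. The case [A = setT] of the last hypothesis says
    that [mu] is the law of [Y]. *)
Lemma ge0_integral_indep {R : realType} {d d1 d2} {X : measurableType d}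
    {T1 : measurableType d1} {T2 : measurableType d2}
    (P : probability X R) (mu : probability T2 R)
    (Z : X -> T1) (Y : X -> T2) (f : T1 * T2 -> \bar R) :
    measurable_fun setT Z -> measurable_fun setT Y ->
    measurable_fun setT f -> (forall z, 0 <= f z) ->
    (forall A B, measurable A -> measurable B ->
      P (Z @^-1` A `&` Y @^-1` B) = P (Z @^-1` A) * mu B) ->
  \int[P]_w f (Z w, Y w) = \int[P]_w \int[mu]_d f (Z w, d).
Proof.
move=> mZ mY mf f0 ind.
pose Z' : {mfun X >-> T1} := HB.pack Z (isMeasurableFun.Build _ _ _ _ _ mZ).
pose ZY w := (Z w, Y w).
have mZY : measurable_fun setT ZY by exact: measurable_fun_pair.
pose ZY' : {mfun X >-> (T1 * T2)%type} :=
  HB.pack ZY (isMeasurableFun.Build _ _ _ _ _ mZY).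
have -> : \int[P]_w f (Z w, Y w) = \int[distribution P ZY']_z f z.
  by rewrite ge0_integral_distribution.
rewrite (eq_measure_integral (distribution P Z' \x mu)); last first.
  by move=> A mA _; apply/esym/product_measure_unique.
rewrite fubini_tonelli1// ge0_integral_distribution//.
- exact: measurable_fun_fubini_tonelli_F.
- by move=> y; apply: integral_ge0.
Qed.

Lemma ge0_integral_fst {R : realType} {d d'} {X : measurableType d}
    {Y : measurableType d'} (P : probability X R) (Q : probability Y R)
    (f : X -> \bar R) :
    measurable_fun setT f -> (forall x, 0 <= f x) ->
  \int[P \x Q]_w f w.1 = \int[P]_x f x.
Proof.
move=> mf f0; rewrite fubini_tonelli1//=; last exact: measurableT_comp.
apply: eq_integral => x _; rewrite [LHS](integral_cst Q measurableT (f x)).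
by rewrite [X in _ * X]probability_setT mule1.
Qed.

(** A null set times the whole second factor is null. This carries almost sure facts about demand
    over to the product with the seed space. *)
Lemma ae_fst {R : realType} {d d'} {X : measurableType d}
    {Y : measurableType d'} (P : probability X R) (Q : probability Y R)
    (A : X -> Prop) :
  {ae P, forall x, A x} -> {ae P \x Q, forall w, A w.1}.
Proof.
move=> [N [mN N0 AN]]; exists (N `*` setT); split; first exact: measurableX.
  by rewrite [LHS]product_measure1E// [X in X * _]N0 mul0e.
by move=> w /AN Nw; split.
Qed.

End Independence.

(** * Measurability and pathwise behaviour of order levels *)

Section Dynamics.
Context {R : realType} (m : inventory_model).

Lemma measurable_period_cost (h p : R) :
  measurable_fun setT (fun z : R * R => period_cost h p z.1 z.2).
Proof.
have mB : measurable_fun setT (fun z : R * R => z.1 - z.2).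
  by apply: measurable_funB.
have mB' : measurable_fun setT (fun z : R * R => z.2 - z.1).
  by apply: measurable_funB.
by apply: measurable_funD; apply: measurable_funM => //;
  exact: measurable_maxr.
Qed.

Lemma period_cost_ge0 (h p y d : R) :
  0 <= h -> 0 <= p -> 0 <= period_cost h p y d.
Proof.
by move=> h0 p0; rewrite addr_ge0// mulr_ge0// le_max lexx orbT.
Qed.

(** The space [X] is arbitrary and only the demands before [t] are assumed measurable. This allows
    [X] to carry the sigma-algebra generated by the seed and the first [t] demands, which is how
    independence of the next demand is obtained. *)
Lemma measurable_information (pi : policy R) {d} {X : measurableType d}
    (u : X -> seed pi) (dem : nat -> X -> R) (x : R) (t : nat) :
    (forall t, measurable_fun setT (@level R pi t)) ->
    measurable_fun setT u ->
    (forall i, (i < t)%N -> measurable_fun setT (dem i)) ->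
  measurable_fun setT (fun w => information m (u w) x (dem^~ w) t).
Proof.
move=> mpi mu; elim: t => [|t IH] mdem /=; first exact: measurable_cst.
have mi : measurable_fun setT (fun w => information m (u w) x (dem^~ w) t).
  by apply: IH => i it; apply: mdem; rewrite ltnS ltnW.
have mi1 := measurableT_comp measurable_fst mi.
have mi2 := measurableT_comp measurable_snd mi.
have md : measurable_fun setT (dem t) by exact: mdem.
pose y w := let i := information m (u w) x (dem^~ w) t in
  level (u w, i.1, i.2).
have my : measurable_fun setT y.
  apply: (measurableT_comp (mpi t)).
  by apply: measurable_fun_pair => //; exact: measurable_fun_pair.
apply: measurable_fun_pair.
- apply: (@measurable_cons _ _ _ _
    (fun w => ((information m (u w) x (dem^~ w) t).2, y w,
      observation m (y w) (dem t w)))) => //.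
  apply: measurable_fun_pair; first exact: measurable_fun_pair.
  by case: m => //; exact: measurable_minr.
- have mB : measurable_fun setT (fun w => y w - dem t w).
    exact: measurable_funB.
  rewrite (_ : (fun w => _) = fun w => next_state m (y w) (dem t w))//.
  by rewrite /next_state; case: m => //; apply: measurable_maxr.
Qed.

Lemma measurable_order_level (pi : policy R) {d} {X : measurableType d}
    (u : X -> seed pi) (dem : nat -> X -> R) (x : R) (t : nat) :
    (forall t, measurable_fun setT (@level R pi t)) ->
    measurable_fun setT u ->
    (forall i, (i < t)%N -> measurable_fun setT (dem i)) ->
  measurable_fun setT (fun w => order_level m (u w) x (dem^~ w) t).
Proof.
move=> mpi mu mdem.
have mi := measurable_information pi u dem x t mpi mu mdem.
have mi1 := measurableT_comp measurable_fst mi.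
have mi2 := measurableT_comp measurable_snd mi.
apply: (measurableT_comp (mpi t)).
by apply: measurable_fun_pair => //; exact: measurable_fun_pair.
Qed.

Lemma feasible_base_stock (s : R) : 0 <= s -> feasible (base_stock s).
Proof.
move=> s0; split=> [t|t i] /=; last by rewrite ge_max !le_max lexx s0 orbT.
by apply: measurable_maxr => //; exact: measurable_snd.
Qed.

(** Feasibility gives a level at least the current inventory, and in both models the next inventory
    is at least level minus demand; the bound follows by induction. *)
Lemma order_level_ge (pi : policy R) (u : seed pi) (x : R) (dem : nat -> R)
    (t : nat) : feasible pi ->
  x - \sum_(i < t) dem i <= order_level m u x dem t.
Proof.
move=> [_ fpi].
have inv_le i : (information m u x dem i).2 <= order_level m u x dem i.
  by apply: le_trans (fpi _ _); rewrite le_max lexx.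
apply: le_trans (inv_le t); elim: t => [|t IH] /=.
  by rewrite big_ord0 subr0.
have {}IH := le_trans IH (inv_le t).
rewrite big_ord_recr/= opprD addrA.
have : x - \sum_(i < t) dem i - dem t <= order_level m u x dem t - dem t.
  by rewrite lerB.
by move=> /le_trans; apply; rewrite /next_state; case: m => //;
  rewrite le_max lexx.
Qed.

(** If the level was [s], the next inventory is at most [s] since demand is nonnegative, so the
    level returns to [s]. If it was [a > s], the truncation at 0 of the lost-sales model is absorbed
    by the maximum with [s >= 0]. Hence the two models give the same levels. *)
Lemma order_level_base_stock (s : R) (u : unit) (x : R) (dem : nat -> R)
    (t : nat) : 0 <= s -> (forall i, (i < t)%N -> 0 <= dem i) ->
  order_level m (pi := base_stock s) u x dem t =
  Num.max s (x - \sum_(i < t) dem i).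
Proof.
move=> s0; elim: t => [|t IH] dem0.
  by rewrite /order_level /= big_ord0 subr0 maxC.
have {}IH := IH (fun i it => dem0 i (ltnW it)).
have dt0 := dem0 t (ltnSn t).
(* One period is unfolded: a base-stock level depends on the records only through the current
   inventory. *)
transitivity (Num.max (next_state m
    (order_level m (pi := base_stock s) u x dem t) (dem t)) s) => //.
rewrite IH big_ord_recr/= opprD addrA.
set a := x - _; rewrite /next_state /Num.max.
by case: (ltP s a) => ?; case: m; case: (ltP (a - dem t) 0) => ?;
  case: (ltP (s - dem t) 0) => ?; case: ifPn => ?; try case: ifPn => ?; lra.
Qed.

End Dynamics.

(** * Convexity, Lipschitz bound and minimization of the one-period mean cost *)

Lemma between_convexE {F : realFieldType} (a y b : F) :
  a <= y <= b -> exists2 l, 0 <= l <= 1 & y = l * a + (1 - l) * b.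
Proof.
move=> /andP[ay yb]; have [ab|ab] := eqVneq a b.
  by exists 1; rewrite ?ler01 ?lexx//; lra.
have ba : 0 < b - a by rewrite subr_gt0 lt_neqAle ab (le_trans ay).
exists ((b - y) / (b - a)); last by field; rewrite gt_eqF.
apply/andP; split; first by rewrite divr_ge0 ?subr_ge0// (le_trans ay).
by rewrite ler_pdivrMr// mul1r lerB.
Qed.

Section MeanCost.
Context {R : realType} (mu : probability R R) (h p Dbar : R).
Hypotheses (h_gt0 : 0 < h) (p_gt0 : 0 < p).
Hypothesis mu_supp : mu `[0, Dbar]%classic = 1%E.

Local Notation I := (`[0, Dbar]%classic : set R).
Local Notation c := (period_cost h p).
Local Notation g := (mean_cost mu h p).

Lemma period_cost_convex (l y z d : R) : 0 <= l <= 1 ->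
  c (l * y + (1 - l) * z) d <= l * c y d + (1 - l) * c z d.
Proof.
move=> /andP[l0 l1]; have l1' : 0 <= 1 - l by rewrite subr_ge0.
have conv (a b : R) : Num.max (l * a + (1 - l) * b) 0 <=
    l * Num.max a 0 + (1 - l) * Num.max b 0.
  rewrite ge_max; apply/andP; split.
    by rewrite lerD// ler_wpM2l// le_max lexx.
  by rewrite addr_ge0// mulr_ge0// le_max lexx orbT.
rewrite /period_cost.
have -> : l * y + (1 - l) * z - d = l * (y - d) + (1 - l) * (z - d) by ring.
have -> : d - (l * y + (1 - l) * z) = l * (d - y) + (1 - l) * (d - z) by ring.
have /(ler_wpM2l (ltW h_gt0)) := conv (y - d) (z - d).
have /(ler_wpM2l (ltW p_gt0)) := conv (d - y) (d - z).
by move=> *; lra.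
Qed.

(** The positive part is 1-Lipschitz. The constant [h + p] does not depend on [d], so it survives
    integration. *)
Lemma period_cost_lipschitz (y z d : R) :
  c y d <= c z d + (h + p) * `|y - z|.
Proof.
have pos (a b : R) : Num.max a 0 <= Num.max b 0 + `|a - b|.
  rewrite /Num.max; case: ifPn; case: ifPn => ? ?;
  have := ler_norm (a - b); have := normr_ge0 (a - b); lra.
have /(ler_wpM2l (ltW h_gt0)) := pos (y - d) (z - d).
have /(ler_wpM2l (ltW p_gt0)) := pos (d - y) (d - z).
have -> : y - d - (z - d) = y - z by ring.
have -> : d - y - (d - z) = z - y by ring.
by rewrite (distrC z y) /period_cost => *; lra.
Qed.

Let mI : measurable I. Proof. exact: measurable_itv. Qed.

Let measurable_cost y : measurable_fun setT (c y).
Proof.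
exact: (measurableT_comp (measurable_period_cost h p) (pair1_measurable y)).
Qed.

Let integrable_cost y : mu.-integrable I (EFin \o c y).
Proof.
apply: measurable_bounded_integrable => //.
- by rewrite [ltLHS]mu_supp ltry.
- exact: measurable_funTS.
(* The Lipschitz bound compares level [y] with level 0, where the cost [p * d] is largest at
   [d = Dbar]. *)
exists (c 0 Dbar + (h + p) * `|y|); split; first exact: num_real.
move=> M cM d; rewrite /= in_itv/= => /andP[d0 dD].
rewrite ger0_norm; last by apply: period_cost_ge0; exact: ltW.
apply: le_trans (ltW cM).
have := period_cost_lipschitz y 0 d; rewrite subr0 => /le_trans; apply.
rewrite lerD2r /period_cost.
have -> : Num.max (0 - d) 0 = 0 by apply/max_r; lra.
have -> : Num.max (0 - Dbar) 0 = 0 by apply/max_r; lra.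
have -> : Num.max (d - 0) 0 = d by rewrite subr0 max_l.
have -> : Num.max (Dbar - 0) 0 = Dbar by rewrite subr0 max_l// (le_trans d0).
by rewrite lerD2l ler_wpM2l// ltW.
Qed.

Let integral_cost y :
  (\int[mu]_d (c y d)%:E = \int[mu]_(d in I) (c y d)%:E)%E.
Proof.
have mIC : measurable (~` I) by exact: measurableC.
rewrite (@ge0_negligible_integral _ _ _ mu setT (~` I))//.
- by rewrite setTD setCK.
- exact/measurable_EFinP.
- by move=> d _; rewrite lee_fin period_cost_ge0 ?ltW.
- by have := probability_setC mu mI; rewrite mu_supp subee.
Qed.

(** The cost is bounded on the support of [mu], so the integral is finite and the [fine] inside
    [Rintegral] loses nothing. *)
Lemma EFin_mean_cost y : ((g y)%:E = \int[mu]_d (c y d)%:E)%E.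
Proof.
rewrite /mean_cost /Rintegral fineK// integral_cost.
by have := integrable_fin_num mI (integrable_cost y).
Qed.

Let mean_costE y : g y = \int[mu]_(d in I) c y d.
Proof. by rewrite /mean_cost /Rintegral integral_cost. Qed.

(** A common form for integrating pointwise bounds over the support: [k = 0] yields convexity,
    [l = 1] the Lipschitz bound, and both together plain monotonicity. *)
Lemma mean_cost_le (l k y z v : R) :
    (forall d, I d -> c y d <= l * c z d + (1 - l) * c v d + k) ->
  g y <= l * g z + (1 - l) * g v + k.
Proof.
move=> le_c; rewrite !mean_costE.
have iZ a x : mu.-integrable I (EFin \o (fun d => a * c x d)).
  exact: (integrableZl mI a (integrable_cost x)).
have iD : mu.-integrable I (EFin \o (fun d => l * c z d + (1 - l) * c v d)).
  exact: (integrableD mI (iZ l z) (iZ (1 - l) v)).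
have ik : mu.-integrable I (EFin \o (fun=> k)).
  exact: (finite_measure_integrable_cst mu k).
apply: le_trans (le_Rintegral mI (integrable_cost y)
  (integrableD mI iD ik) le_c) _.
rewrite (RintegralD mI iD ik) (RintegralD mI (iZ _ _) (iZ _ _)).
by rewrite !RintegralZl// Rintegral_cst// [X in fine X]mu_supp mulr1.
Qed.

Lemma mean_cost_ge0 y : 0 <= g y.
Proof. by apply: Rintegral_ge0 => d _; exact/period_cost_ge0/ltW/p_gt0/ltW. Qed.

Lemma mean_cost_convex (l y z : R) : 0 <= l <= 1 ->
  g (l * y + (1 - l) * z) <= l * g y + (1 - l) * g z.
Proof.
move=> l01; rewrite -[leRHS]addr0; apply: mean_cost_le => d _.
by rewrite addr0 period_cost_convex.
Qed.

Lemma mean_cost_lipschitz (y z : R) : g y <= g z + (h + p) * `|y - z|.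
Proof.
have := @mean_cost_le 1 ((h + p) * `|y - z|) y z z.
rewrite subrr !mul0r !mul1r !addr0; apply => d _.
by rewrite mul0r mul1r addr0 period_cost_lipschitz.
Qed.

Lemma continuous_mean_cost : continuous g.
Proof.
have hp : 0 < h + p by rewrite addr_gt0.
move=> x; apply/cvgrPdist_le => e e0; apply/nbhs_ballP.
exists (e / (h + p)) => /=; first by rewrite divr_gt0.
move=> y; rewrite /ball/= ltr_pdivlMr// mulrC => /ltW xy.
have := mean_cost_lipschitz x y; have := mean_cost_lipschitz y x.
by rewrite ler_norml (distrC y x) => *; apply/andP; split; lra.
Qed.

Hypothesis Dbar_gt0 : 0 < Dbar.
Local Notation sstar := (least_minimizer mu h p Dbar).

(** Continuity on the compact interval makes the set of minimizers nonempty. Its infimum belongs to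
    it: a minimizer within [e / (h + p)] of the infimum shows, by the Lipschitz bound, that the cost
    there exceeds the minimum by at most [e]. *)
Lemma least_minimizerP : minimizers mu h p Dbar sstar.
Proof.
have gcont : {within `[0, Dbar], continuous g}.
  exact/continuous_subspaceT/continuous_mean_cost.
have [y0 y0I y0min] := EVT_min (ltW Dbar_gt0) gcont.
have M0 : minimizers mu h p Dbar !=set0 by exists y0; split.
have hasinf : has_inf (minimizers mu h p Dbar).
  by split => //; exists 0 => y [+ _]; rewrite in_itv/= => /andP[].
have hp : 0 < h + p by rewrite addr_gt0.
have sstar_ge0 : 0 <= sstar.
  by apply: lb_le_inf => // y [+ _]; rewrite in_itv/= => /andP[].
have sstar_le y : minimizers mu h p Dbar y -> sstar <= y.
  by move=> My; exact: ge_inf hasinf.2 _ My.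
have sstarD : sstar <= Dbar.
  have [y My] := M0; apply: le_trans (sstar_le _ My) _.
  by case: My; rewrite in_itv/= => /andP[].
split=> [|z zI]; first by rewrite in_itv/= sstar_ge0.
apply/ler_addgt0Pr => e e0.
have [y My ye] := inf_adherent (divr_gt0 e0 hp) hasinf.
apply: le_trans (mean_cost_lipschitz _ y) _.
apply: lerD; first exact: My.2.
rewrite mulrC -ler_pdivlMr// distrC ger0_norm ?subr_ge0 ?sstar_le//.
by rewrite lerBlDl ltW.
Qed.

Lemma least_minimizer_le y : minimizers mu h p Dbar y -> sstar <= y.
Proof.
move=> My; apply: ge_inf My.
by exists 0 => z [+ _]; rewrite in_itv/= => /andP[].
Qed.

Lemma mean_cost_least_minimizer y : g sstar <= g y.
Proof.
have [_ smin] := least_minimizerP.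
(* Clamping y to [0, Dbar] lowers the cost for every demand in [0, Dbar]. *)
pose z := Num.max 0 (Num.min y Dbar).
have zI : z \in `[0, Dbar].
  by rewrite in_itv/= le_max lexx/= ge_max ltW//= ge_min lexx orbT.
apply: le_trans (smin _ zI) _.
have := @mean_cost_le 1 0 z y y.
rewrite subrr !mul0r !mul1r !addr0; apply => d.
rewrite /= in_itv/= => /andP[d0 dD]; rewrite mul0r mul1r !addr0 /z /period_cost.
apply: lerD; (apply: ler_wpM2l; first exact: ltW);
  case: (leP y Dbar) => yD; [case: (leP 0 y) => y0|case: (leP 0 Dbar) => D0|
    case: (leP 0 y) => y0|case: (leP 0 Dbar) => D0];
  rewrite /Num.max; repeat case: ifPn => ?; lra.
Qed.

(** Here [a] is a convex combination of [sstar] and [b], so convexity and the global minimality of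
    [sstar] bound its cost by that of [b]. *)
Lemma mean_cost_nondecreasing a b : sstar <= a -> a <= b -> g a <= g b.
Proof.
move=> sa ab; have [|l /andP[l0 l1] ->] := @between_convexE R sstar a b.
  by rewrite sa.
have := mean_cost_least_minimizer b.
have := @mean_cost_convex l sstar b; rewrite l0 l1 => /(_ isT).
by move=> *; nra.
Qed.

Lemma mean_cost_nonincreasing a b : a <= b -> b <= sstar -> g b <= g a.
Proof.
move=> ab bs; have [|l /andP[l0 l1] ->] := @between_convexE R a b sstar.
  by rewrite ab.
have := mean_cost_least_minimizer a.
have := @mean_cost_convex l a sstar; rewrite l0 l1 => /(_ isT).
by move=> *; nra.
Qed.

(** If [a] lies below both levels, the two sides are equal; if above both, the gap is nonnegative.
    For [s <= a < sstar] the claim is [g a <= g s], and for [sstar <= a < s] it is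
    [g sstar <= g a]. *)
Lemma mean_cost_max_gap (s a : R) :
  g (Num.max s a) <= g (Num.max sstar a) + (g s - g sstar).
Proof.
have gs := mean_cost_least_minimizer s.
have [sa|as_] := leP s a; have [ta|at_] := leP sstar a.
- lra.
- have := mean_cost_nonincreasing s a sa (ltW at_); lra.
- have := mean_cost_nondecreasing sstar a (lexx _) ta; lra.
- lra.
Qed.

Lemma mean_cost_max_le (a y : R) : a <= y -> g (Num.max sstar a) <= g y.
Proof.
move=> ay; have [sa|_] := leP sstar a.
- exact: mean_cost_nondecreasing.
- exact: mean_cost_least_minimizer.
Qed.

End MeanCost.

(** * Independence of the current demand from the current order level *)

Section IidDemand.
Context {R : realType} {d : measure_display} {Omega : measurableType d}.
Context {P : probability Omega R} {T : nat} {D : nat -> {RV P >-> R}}.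
Context {mu : probability R R} (m : inventory_model).
Hypothesis D_iid : iid_upto mu T D.

Let mD t : measurable_fun setT (D t). Proof. exact: measurable_funP. Qed.

Let mDB t (B : set R) : measurable B -> measurable (D t @^-1` B).
Proof. by move=> mB; rewrite -[X in measurable X]setTI; exact: mD. Qed.

Let past t (B : nat -> set R) := [set w | forall i, (i < t)%N -> B i (D i w)].

Let measurable_past t B : (forall i, measurable (B i)) -> measurable (past t B).
Proof.
move=> mB; rewrite (_ : past t B = \bigcap_(i in `I_t) (D i @^-1` B i)).
  by apply: bigcap_measurableType => i _; exact: mDB.
by apply/seteqP; split.
Qed.

Let probability_past t (B : nat -> set R) :
    (t <= T)%N -> (forall i, measurable (B i)) ->
  P (past t B) = (\prod_(i < t) P (D i @^-1` B i))%E.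
Proof.
(* The independence hypothesis speaks of all [T] periods; padding with [setT] from [t] on adds only
   factors 1. *)
move=> tT mB; pose B' i := if (i < t)%N then B i else setT.
have mB' i : measurable (B' i) by rewrite /B'; case: ifPn.
have := D_iid.1 B' mB'.
rewrite (_ : [set w | _] = past t B); last first.
  apply/seteqP; split=> w /= Bw i it.
    by have := Bw i (leq_trans it tT); rewrite /B' it.
  by rewrite /B'; case: ifPn => // /Bw.
move=> ->; rewrite (big_ord_widen T (fun i => P (D i @^-1` B i)) tT).
rewrite [RHS]big_mkcond; apply: eq_bigr => i _; rewrite /B'; case: ifPn => // _.
by rewrite preimage_setT probability_setT.
Qed.

Lemma order_level_indep (pi : policy R) (x : R) (t : nat) (A B : set R) :
    (forall t, measurable_fun setT (@level R pi t)) -> (t < T)%N ->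
    measurable A -> measurable B ->
  let Y w := order_level m w.2 x (fun i => D i w.1) t in
  ((P \x seed_law pi) (Y @^-1` A `&` (fun w => D t w.1) @^-1` B) =
   (P \x seed_law pi) (Y @^-1` A) * mu B)%E.
Proof.
move=> mpi tT mA mB Y.
(* The pi-system of past-and-seed rectangles: D_t is independent of each,
   and the order level is measurable for the sigma-algebra they generate. *)
pose G := [set S | exists C U, [/\ forall i, measurable (C i), measurable U &
  S = past t C `*` U]] : set (set (Omega * seed pi)).
have mC : measurable ((fun w : Omega * seed pi => D t w.1) @^-1` B).
  rewrite -[X in measurable X]setTI.
  exact: (measurableT_comp (mD t) measurable_fst).
have CE : (fun w : Omega * seed pi => D t w.1) @^-1` B =
    (D t @^-1` B) `*` setT.
  by apply/seteqP; split=> [w|w []].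
have muB : ((P \x seed_law pi) ((fun w => D t w.1) @^-1` B) = mu B)%E.
  rewrite CE product_measure1E//; last exact: mDB.
  by rewrite [X in (_ * X)%E]probability_setT mule1; exact: D_iid.2.
rewrite -muB; apply: (@g_sigma_algebra_indep _ _ _ _ G) => //.
- move=> _ [C [U [mC' mU ->]]].
  by apply: measurableX => //; exact: measurable_past.
- move=> _ _ [C [U [mC' mU ->]]] [C2 [U2 [mC2 mU2 ->]]].
  exists (fun i => C i `&` C2 i), (U `&` U2).
  split; [by move=> i; exact: measurableI|exact: measurableI|].
  rewrite -setXI; congr (_ `*` _); apply/seteqP; split=> w /=.
    by move=> [C1w C2w] i it; split; [exact: C1w|exact: C2w].
  by move=> Cw; split=> i it; have [] := Cw i it.
- move=> _ [C [U [mC' mU ->]]]; rewrite [X in (_ * X)%E]muB CE -setXI setIT.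
  have mpast : measurable (past t C) by exact: measurable_past.
  have mpastB : measurable (past t C `&` D t @^-1` B).
    by apply: measurableI => //; exact: mDB.
  rewrite [LHS]product_measure1E// [X in _ = (X * _)%E]product_measure1E//.
  rewrite muleAC; congr (_ * _)%E.
  (* The event on [D t] becomes coordinate [t] of a cylinder on the first [t.+1] demands, so the
     product rule evaluates both sides. *)
  pose C' i := if (i < t)%N then C i else B.
  have mC'' i : measurable (C' i) by rewrite /C'; case: ifPn.
  rewrite (_ : _ `&` _ = past t.+1 C'); last first.
    apply/seteqP; split=> w /=.
      move=> [Cw Bw] i; rewrite /C' ltnS leq_eqVlt => /predU1P[->|it].
        by rewrite ltnn.
      by rewrite it; exact: Cw.
    move=> Cw; split; last by have := Cw t (ltnSn t); rewrite /C' ltnn.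
    by move=> i it; have := Cw i (ltnW it); rewrite /C' it.
  rewrite [LHS]probability_past// [X in _ = (X * _)%E]probability_past 1?ltnW//.
  rewrite big_ord_recr/=; congr (_ * _)%E.
    by apply: eq_bigr => i _; rewrite /C' ltn_ord.
  by rewrite /C' ltnn; exact: D_iid.2.
(* On the same outcomes endowed with [<<s G>>], the goal is measurability of the order level; it
   suffices that the seed and each demand before [t] be measurable there. *)
- pose X := g_sigma_algebraType G.
  have msnd : measurable_fun (setT : set X) snd.
    move=> _ U mU; rewrite setTI; apply: sub_sigma_algebra.
    exists (fun=> setT), U; split=> //.
    by apply/seteqP; split=> [w|w []].
  have mdem i : (i < t)%N -> measurable_fun (setT : set X) (fun w => D i w.1).
    move=> it _ C mC'; rewrite setTI; apply: sub_sigma_algebra.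
    exists (fun j => if j == i then C else setT), setT; split => //.
      by move=> j; case: ifPn.
    apply/seteqP; split=> w /=.
      by move=> Cw; split=> // j _; case: eqP => // ->.
    by move=> [/(_ i it)]; rewrite eqxx.
  have := @measurable_order_level R m pi _ (g_sigma_algebraType G) snd
    (fun i w => D i w.1) x t mpi msnd mdem.
  by move=> /(_ measurableT A mA); rewrite setTI.
Qed.

End IidDemand.

(** * Expected costs of policies and of base-stock levels *)

Section ExpectedCost.
Context {R : realType} {d : measure_display} {Omega : measurableType d}.
Context {P : probability Omega R} {T : nat} (D : nat -> {RV P >-> R}).
Context (mu : probability R R) (m : inventory_model) (Dbar h p : R).
Hypotheses (Dbar_gt0 : 0 < Dbar) (h_gt0 : 0 < h) (p_gt0 : 0 < p).
Hypotheses (mu_supp : mu `[0, Dbar]%classic = 1%E) (D_iid : iid_upto mu T D).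

Local Notation g := (mean_cost mu h p).
Local Notation sstar := (least_minimizer mu h p Dbar).

Let mD t : measurable_fun setT (D t). Proof. exact: measurable_funP. Qed.

Let measurable_g : measurable_fun setT g.
Proof.
apply: continuous_measurable_fun.
exact: (continuous_mean_cost mu h p Dbar h_gt0 p_gt0 mu_supp).
Qed.

Let g_ge0 y : 0 <= g y. Proof. exact: mean_cost_ge0. Qed.

(** Costs are nonnegative, so sum and integral commute even when the total is infinite. In each
    period the demand is then integrated out by [ge0_integral_indep]. *)
Lemma expected_costE (pi : policy R) (x : R) :
    (forall t, measurable_fun setT (@level R pi t)) ->
  expected_cost m D h p T pi x = (\sum_(t < T) \int[P \x seed_law pi]_w
    (g (order_level m w.2 x (fun i => D i w.1) t))%:E)%E.
Proof.
move=> mpi; pose Y t (w : Omega * seed pi) :=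
  order_level m w.2 x (fun i => D i w.1) t.
have mDfst t : measurable_fun setT (fun w : Omega * seed pi => D t w.1).
  exact: (measurableT_comp (mD t) measurable_fst).
have mY t : measurable_fun setT (Y t).
  exact: (@measurable_order_level R m pi _ _ snd (fun i w => D i w.1)).
have mc := measurable_period_cost h p.
have c0 y z : (0 <= (period_cost h p y z)%:E)%E.
  by rewrite lee_fin period_cost_ge0// ltW.
rewrite /expected_cost /total_cost; under eq_integral do rewrite -sumEFin.
rewrite ge0_integral_sum//; last first.
  move=> t; apply/measurable_EFinP.
  exact: (measurableT_comp mc (measurable_fun_pair (mY t) (mDfst t))).
apply: eq_bigr => t _.
rewrite (@ge0_integral_indep _ _ _ _ _ _ _ _ mu (Y t) (fun w => D t w.1)
  (fun z => (period_cost h p z.1 z.2)%:E))//.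
- apply: eq_integral => w _.
  by rewrite -(EFin_mean_cost _ _ _ _ h_gt0 p_gt0 mu_supp).
- exact/measurable_EFinP.
- by move=> A B mA mB; exact: (order_level_indep m D_iid pi x t A B mpi).
Qed.

Let demand_ae : {ae P, forall w, forall t, (t < T)%N -> 0 <= D t w}.
Proof.
have mI : measurable (~` `[0, Dbar]%classic : set R) by exact: measurableC.
have DI t : (t < T)%N -> {ae P, forall w, 0 <= D t w}.
  move=> tT; exists (D t @^-1` ~` `[0, Dbar]%classic); split.
  - by rewrite -[X in measurable X]setTI; exact: mD.
  - transitivity (mu (~` `[0, Dbar]%classic)); first exact: D_iid.2.
    have := probability_setC mu (measurable_itv `[0, Dbar]).
    by rewrite mu_supp subee.
  - by move=> w /= Dw; apply: contra_not Dw; rewrite in_itv/= => /andP[].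
(* Indexing by the finite type ['I_T] lets the finitely many null sets be merged into one. *)
suff : {ae P, forall w, forall t : 'I_T, 0 <= D t w}.
  by apply: filterS => w Dw t tT; exact: (Dw (Ordinal tT)).
by apply: filter_forall => t; exact: DI.
Qed.

(** The inventory of the backlog model when nothing is ever ordered. *)
Definition no_order (x : R) (t : nat) (w : Omega) : R :=
  x - \sum_(i < t) D i w.

Let measurable_no_order x t : measurable_fun setT (no_order x t).
Proof. by apply: measurable_funB => //; exact: measurable_sum. Qed.

Let no_order_le x t : (t <= T)%N -> {ae P, forall w, no_order x t w <= x}.
Proof.
move=> tT; apply: filterS demand_ae => w Dw.
by rewrite lerBlDl lerDr sumr_ge0// => i _; rewrite Dw// (leq_trans _ tT).
Qed.

(** An integral over the demand space alone, free of model and seed, so that it can be compared with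
    policies on any seed space. *)
Definition base_stock_cost (s x : R) (t : nat) : \bar R :=
  (\int[P]_w (g (Num.max s (no_order x t w)))%:E)%E.

Let measurable_base s x t :
  measurable_fun setT (fun w => (g (Num.max s (no_order x t w)))%:E).
Proof.
apply/measurable_EFinP/(measurableT_comp measurable_g).
exact: measurable_maxr.
Qed.

Lemma expected_cost_base_stock (s x : R) : 0 <= s ->
  expected_cost m D h p T (base_stock s) x =
  (\sum_(t < T) base_stock_cost s x t)%E.
Proof.
move=> s0; have [mlev _] := feasible_base_stock s s0.
rewrite expected_costE//; apply: eq_bigr => t _.
rewrite /base_stock_cost -(ge0_integral_fst P (seed_law (base_stock s))
  (fun w => (g (Num.max s (no_order x t w)))%:E))//;
  last by move=> w; rewrite lee_fin.
pose Y w := order_level m (pi := base_stock s) w.2 x (fun i => D i w.1) t.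
have mY : measurable_fun setT Y.
  apply: (@measurable_order_level R m (base_stock s) _ _ snd
    (fun i w => D i w.1)) => //.
  by move=> i _; exact: (measurableT_comp (mD i) measurable_fst).
apply: ge0_ae_eq_integral => //.
- exact/measurable_EFinP/(measurableT_comp measurable_g).
- exact: (measurableT_comp (measurable_base s x t) measurable_fst).
- by move=> w _; rewrite lee_fin.
- by move=> w _; rewrite lee_fin.
move: (ae_fst P (seed_law (base_stock s)) _ demand_ae).
apply: filterS => w Dw _.
rewrite /Y order_level_base_stock// => i it.
exact/Dw/(ltn_trans it).
Qed.

(** The comparison is pathwise: for every outcome and every seed, the level is at least
    [no_order x t], so [mean_cost_max_le] applies. Neither randomization nor extra information can
    beat this bound. *)
Lemma expected_cost_ge (pi : policy R) (x : R) : feasible pi ->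
  (\sum_(t < T) base_stock_cost sstar x t <= expected_cost m D h p T pi x)%E.
Proof.
move=> fpi; rewrite expected_costE; last exact: fpi.1.
apply: lee_sum => t _.
rewrite /base_stock_cost -(ge0_integral_fst P (seed_law pi)
  (fun w => (g (Num.max sstar (no_order x t w)))%:E))//;
  last by move=> w; rewrite lee_fin.
apply: ge0_le_integral => //.
- by move=> w _; rewrite lee_fin.
- exact: (measurableT_comp (measurable_base sstar x t) measurable_fst).
- apply/measurable_EFinP/(measurableT_comp measurable_g).
  apply: (@measurable_order_level R m pi _ _ snd (fun i w => D i w.1)) => //.
    exact: fpi.1.
  by move=> i _; exact: (measurableT_comp (mD i) measurable_fst).
move=> w _; rewrite lee_fin.
apply: (mean_cost_max_le mu h p Dbar h_gt0 p_gt0 mu_supp Dbar_gt0).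
exact: order_level_ge.
Qed.

Let sstar_ge0 : 0 <= sstar.
Proof.
have [] := least_minimizerP mu h p Dbar h_gt0 p_gt0 mu_supp Dbar_gt0.
by rewrite in_itv/= => /andP[].
Qed.

Lemma optimal_cost_base_stock (x : R) :
  optimal_cost m D h p T x = expected_cost m D h p T (base_stock sstar) x.
Proof.
apply/le_anti/andP; split.
  by apply: ereal_inf_lbound; exists (base_stock sstar) => //;
    exact: feasible_base_stock.
apply: le_ereal_inf_tmp => _ [pi fpi ->].
by rewrite expected_cost_base_stock// expected_cost_ge.
Qed.

(** Almost surely the level lies between 0 and [Num.max s x], so the Lipschitz bound from level 0
    gives the constant [M]. Finiteness makes the regret a genuine difference. *)
Lemma base_stock_cost_fin_num (s x : R) (t : nat) : 0 <= s -> (t <= T)%N ->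
  base_stock_cost s x t \is a fin_num.
Proof.
move=> s0 tT; pose M := g 0 + (h + p) * Num.max s x.
have hp : 0 < h + p by rewrite addr_gt0.
have M0 : 0 <= M by rewrite addr_ge0// mulr_ge0 ?(ltW hp)// le_max s0.
rewrite ge0_fin_numE; last by apply: integral_ge0 => w _; rewrite lee_fin.
apply: (@le_lt_trans _ _ (\int[P]_w (cst M%:E w))%E); last first.
  by rewrite integral_cst// [X in (_ * X)%E]probability_setT mule1 ltry.
apply: ae_ge0_le_integral => //; first by move=> w _; rewrite lee_fin.
move: (no_order_le x t tT); apply: filterS => w xw _; rewrite lee_fin.
have := mean_cost_lipschitz mu h p Dbar h_gt0 p_gt0 mu_supp
  (Num.max s (no_order x t w)) 0.
move=> /le_trans; apply; rewrite subr0 ger0_norm ?le_max ?s0//.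
by rewrite lerD2l ler_wpM2l ?(ltW hp)// ge_max !le_max lexx/= xw orbT.
Qed.

Lemma base_stock_cost_gap (s x : R) (t : nat) : (base_stock_cost s x t <=
  base_stock_cost sstar x t + (g s - g sstar)%:E)%E.
Proof.
have gap0 : 0 <= g s - g sstar.
  by rewrite subr_ge0 (mean_cost_least_minimizer mu h p Dbar).
have -> : ((g s - g sstar)%:E = \int[P]_w cst (g s - g sstar)%:E w)%E.
  by rewrite integral_cst// [X in (_ * X)%E]probability_setT mule1.
rewrite -ge0_integralD//=; last by move=> w _; rewrite lee_fin.
apply: ge0_le_integral => //.
- by move=> w _; rewrite lee_fin.
- exact: emeasurable_funD.
move=> w _; rewrite -EFinD lee_fin.
exact: (mean_cost_max_gap mu h p Dbar h_gt0 p_gt0 mu_supp Dbar_gt0).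
Qed.

(** Demands are almost surely nonnegative, so the inventory without orders never exceeds [x <= s]
    and the level is always exactly [s]. *)
Lemma base_stock_cost_below (s x : R) (t : nat) : x <= s -> (t <= T)%N ->
  base_stock_cost s x t = (g s)%:E.
Proof.
move=> xs tT; transitivity (\int[P]_w cst (g s)%:E w)%E; last first.
  by rewrite integral_cst// [X in (_ * X)%E]probability_setT mule1.
apply: ge0_ae_eq_integral => //.
- by move=> w _; rewrite lee_fin.
- by move=> w _; rewrite lee_fin.
move: (no_order_le x t tT); apply: filterS => w xw _.
by rewrite max_l// (le_trans xw).
Qed.

End ExpectedCost.

Theorem proposition3 (R : realType) (d : measure_display)
    (Omega : measurableType d) (P : probability Omega R)
    (T : nat) (D : nat -> {RV P >-> R}) (mu : probability R R)
    (Dbar h p : R) (m : inventory_model)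
    (Dbar_gt0 : 0 < Dbar) (h_gt0 : 0 < h) (p_gt0 : 0 < p)
    (mu_supp : mu `[0, Dbar]%classic = 1%E) (D_iid : iid_upto mu T D) :
  let g := mean_cost mu h p in
  let sstar := least_minimizer mu h p Dbar in
  let V := fun s : R => expected_cost m D h p T (base_stock s) in
  let Vstar := optimal_cost m D h p T in
  [/\ minimizers mu h p Dbar sstar /\
        (forall y : R, minimizers mu h p Dbar y -> sstar <= y),
      optimal m D h p T (base_stock sstar) &
      forall s : R, s \in `[0, Dbar] ->
      [/\ forall x : R, x \in `[0, Dbar] ->
            V s x \is a fin_num /\ Vstar x \is a fin_num,
          (ereal_sup [set V s x - Vstar x | x in `[0%R, Dbar]%classic]
             <= (T%:R * (g s - g sstar))%:E)%E &
          forall x : R, x \in `[0, Dbar] -> x <= Num.min s sstar ->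
            (V s x - Vstar x = (T%:R * (g s - g sstar))%:E)%E]].
Proof.
move=> g sstar V Vstar.
have sstar_min : minimizers mu h p Dbar sstar.
  exact: (least_minimizerP mu h p Dbar).
have sstar0 : 0 <= sstar by case: sstar_min; rewrite in_itv/= => /andP[].
have VE s x : 0 <= s -> V s x = (\sum_(t < T) base_stock_cost D mu h p s x t)%E.
  exact: (expected_cost_base_stock D mu m Dbar).
have VstarE x : Vstar x = V sstar x.
  exact: (optimal_cost_base_stock D mu m Dbar).
have Vfin s x : 0 <= s -> V s x \is a fin_num.
  move=> s0; rewrite VE//; rewrite sum_fin_num; apply/allP => _ /mapP[t _ ->].
  have := ltnW (ltn_ord t).
  exact: (base_stock_cost_fin_num D mu Dbar h p h_gt0 p_gt0 mu_supp D_iid).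
have sumE (a : R) : (\sum_(t < T) a%:E = (T%:R * a)%:E)%E.
  by rewrite sumEFin sumr_const card_ord mulr_natl.
split; first by split=> // y; exact: least_minimizer_le.
  by split=> [|x]; [exact: feasible_base_stock|exact/esym/VstarE].
move=> s; rewrite in_itv/= => /andP[s0 _]; split.
- by move=> x _; rewrite VstarE !Vfin.
- apply: ge_ereal_sup => _ [x _ <-].
  (* Finiteness of the optimal cost allows moving it to the right, where [T] times the gap is spread
     over the periods. *)
  rewrite VstarE leeBlDl ?Vfin// !VE// -sumE -big_split/=.
  by apply: lee_sum => t _; exact: (base_stock_cost_gap D mu Dbar).
- move=> x _; rewrite le_min => /andP[xs xsstar].
  rewrite VstarE !VE//.
  (* Used with [y = s] and [y = sstar]: starting below both levels, each policy has a constant cost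
     per period. *)
  have costE y (t : 'I_T) : x <= y -> base_stock_cost D mu h p y x t = (g y)%:E.
    move=> xy; have := ltnW (ltn_ord t).
    exact: (base_stock_cost_below D mu Dbar h p h_gt0 p_gt0 mu_supp D_iid).
  rewrite (eq_bigr (fun=> (g s)%:E)); last first.
    by move=> t _; exact: costE.
  rewrite [X in (_ - X)%E](eq_bigr (fun=> (g sstar)%:E)); last first.
    by move=> t _; exact: costE.
  by rewrite !sumE -EFinB mulrBr.
Qed.
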